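(* Let $d\ge 2$ and let $\mathcal{H}_S\cong\mathcal{H}_A\cong\mathbb{C}^d$ be the Hilbert spaces of a system $S$ and an ancilla $A$. Let $\mathcal{E}_{t_1},\mathcal{E}_{t_2}$ be completely positive trace-preserving (CPT) maps on operators on $\mathcal{H}_S$, and let $\rho^{0}_{S+A}$ be an arbitrary density operator on $\mathcal{H}_S\otimes\mathcal{H}_A$. For $j=1,2$ set $$\rho^{(t_j)}_{S+A}=(\mathcal{E}_{t_j}\otimes\mathrm{id}_A)\,\rho^{0}_{S+A},$$ and let $\rho_S(t_1)=\operatorname{tr}_A\rho^{(t_1)}_{S+A}$, $\rho_A(t_1)=\operatorname{tr}_S\rho^{(t_1)}_{S+A}$. Define $$F_\Delta(t_1,t_2)=\min\Big\{\sqrt{2\big(1-\operatorname{tr}\rho_S(t_1)^2\big)},\ \sqrt{2\big(1-\operatorname{tr}\rho_A(t_1)^2\big)}\Big\}-\tilde N\,\max\Big\{\big\|(\rho^{(t_2)}_{S+A})^{T_S}\big\|_1-1,\ \big\|(\rho^{(t_2)}_{S+A})^{T_A}\big\|_1-1\Big\},$$ where $\tilde N=\sqrt{2/(d(d-1))}$, $\|\cdot\|_1$ is the trace norm and $T_S$, $T_A$ denote partial transposition on $S$ resp. $A$, and put $\Delta(t_1,t_2)=\max\{0,-F_\Delta(t_1,t_2)\}$. If $\Delta(t_1,t_2)>0$, then the pair $(\mathcal{E}_{t_1},\mathcal{E}_{t_2})$ is not realizable with classical memory; that is, there do not exist operators $\{K_i\}$ on $\mathcal{H}_S$ and CPT maps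 $\{\Phi_i\}$ on $\mathcal{H}_S$ such that for all operators $\rho$ on $\mathcal{H}_S$ $$\mathcal{E}_{t_1}\rho=\sum_i K_i\rho K_i^\dagger,\qquad \mathcal{E}_{t_2}\rho=\sum_i\Phi_i\big(K_i\rho K_i^\dagger\big).$$
   Context: A pair of CPT maps $(\mathcal{E}_{t_1},\mathcal{E}_{t_2})$ (a ''dynamics'') on a $d$-dimensional system is called realizable with classical memory if there exist a set of Kraus operators $\{K_i\}$ (with $\sum_i K_i^\dagger K_i=\mathbb{1}$) and CPT maps $\Phi_i$ such that $\mathcal{E}_{t_1}\rho=\sum_i K_i\rho K_i^\dagger$ and $\mathcal{E}_{t_2}\rho=\sum_i\Phi_i(K_i\rho K_i^\dagger)$ for all $\rho$; otherwise it is said to require quantum memory. In the main application $\rho^0_{S+A}$ is the maximally entangled state $|\Psi^+\rangle\langle\Psi^+|$ with $|\Psi^+\rangle=d^{-1/2}\sum_i|i\rangle_S|i\rangle_A$, so that $\rho^{(t_j)}_{S+A}$ is the Choi state of $\mathcal{E}_{t_j}$; the theorem is stated for arbitrary $\rho^0_{S+A}$. *)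

(* Defs.v *)
From Stdlib Require Import ClassicalEpsilon.
From HB Require Import structures.
From mathcomp Require Import all_boot all_order all_algebra.
From mathcomp Require Import reals.
From mathcomp Require Import complex mxtens.
Set Implicit Arguments.
Unset Strict Implicit.
Unset Printing Implicit Defensive.
Import Order.TTheory GRing.Theory Num.Theory.
Local Open Scope ring_scope.

Section QDefs.
Variable R : realType.
Local Notation C := R[i].

Definition adjmx m n (X : 'M[C]_(m, n)) : 'M[C]_(n, m) :=
  (map_mx (@conjc R) X)^T.

Definition psd n (X : 'M[C]_n) : Prop :=
  forall v : 'cV[C]_n, 0 <= ((adjmx v) *m X *m v) 0 0.

Definition density n (X : 'M[C]_n) : Prop := psd X /\ \tr X = 1.

(* trace norm ||X||_1 = tr sqrt(X^dagger X), where sqrt(X^dagger X) is the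
   (unique) positive semidefinite P with P P = X^dagger X *)
Definition msqrt n (Y : 'M[C]_n) : 'M[C]_n :=
  epsilon (inhabits 0) (fun P : 'M[C]_n => psd P /\ P *m P = Y).
Definition trnorm n (X : 'M[C]_n) : R := complex.Re (\tr (msqrt (adjmx X *m X))).

Definition bi d e (i : 'I_d) (a : 'I_e) : 'I_(d * e) := mxtens_index (i, a).
Definition bS d e (p : 'I_(d * e)) : 'I_d := (mxtens_unindex p).1.
Definition bA d e (p : 'I_(d * e)) : 'I_e := (mxtens_unindex p).2.

Definition ptrA d e (X : 'M[C]_(d * e)) : 'M[C]_d :=
  \matrix_(i, j) \sum_(a < e) X (bi i a) (bi j a).
Definition ptrS d e (X : 'M[C]_(d * e)) : 'M[C]_e :=
  \matrix_(a, b) \sum_(i < d) X (bi i a) (bi i b).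

Definition ptransS d e (X : 'M[C]_(d * e)) : 'M[C]_(d * e) :=
  \matrix_(p, q) X (bi (bS q) (bA p)) (bi (bS p) (bA q)).
Definition ptransA d e (X : 'M[C]_(d * e)) : 'M[C]_(d * e) :=
  \matrix_(p, q) X (bi (bS p) (bA q)) (bi (bS q) (bA p)).

(* (Phi ⊗ id_e) applied to an operator on C^d ⊗ C^e *)
Definition ampl d e (Phi : 'M[C]_d -> 'M[C]_d) (X : 'M[C]_(d * e))
  : 'M[C]_(d * e) :=
  \matrix_(p, q)
     Phi (\matrix_(i, j) X (bi i (bA p)) (bi j (bA q))) (bS p) (bS q).

Definition CPT d (Phi : 'M[C]_d -> 'M[C]_d) : Prop :=
  [/\ forall (c : C) (X Y : 'M[C]_d), Phi (c *: X + Y) = c *: Phi X + Phi Y,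
      forall (e : nat) (X : 'M[C]_(d * e)), psd X -> psd (@ampl d e Phi X)
    & forall X : 'M[C]_d, \tr (Phi X) = \tr X].

Definition classical_memory d (E1 E2 : 'M[C]_d -> 'M[C]_d) : Prop :=
  exists (n : nat) (K : 'I_n -> 'M[C]_d) (Phi : 'I_n -> 'M[C]_d -> 'M[C]_d),
    [/\ forall i, CPT (Phi i),
        forall rho, E1 rho = \sum_(i < n) K i *m rho *m adjmx (K i)
      & forall rho, E2 rho = \sum_(i < n) Phi i (K i *m rho *m adjmx (K i))].

Definition F_Delta d (E1 E2 : 'M[C]_d -> 'M[C]_d) (rho0 : 'M[C]_(d * d)) : R :=
  let rho1 := @ampl d d E1 rho0 in
  let rho2 := @ampl d d E2 rho0 in
  let rS := ptrA rho1 in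
  let rA := ptrS rho1 in
  let Nt := Num.sqrt (2 / (d%:R * (d%:R - 1))) in
  Num.min (Num.sqrt (2 * (1 - complex.Re (\tr (rS *m rS)))))
          (Num.sqrt (2 * (1 - complex.Re (\tr (rA *m rA)))))
  - Nt * Num.max (trnorm (ptransS rho2) - 1) (trnorm (ptransA rho2) - 1).

Definition Delta d (E1 E2 : 'M[C]_d -> 'M[C]_d) (rho0 : 'M[C]_(d * d)) : R :=
  Num.max 0 (- F_Delta E1 E2 rho0).

End QDefs.

(* Main.v *)
(* A classical-memory realization unravels [rho0] into unnormalized pure states
   |M_i>, with (E1 (x) id) rho0 = sum_i |M_i><M_i| and
   (E2 (x) id) rho0 = sum_i (Phi_i (x) id) |M_i><M_i|.  Since [Phi_i (x) id]
   commutes with the transposition on A and contracts the trace norm, the negativity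
   at time t2 is at most the sum of those of the |M_i>.  If |M> has Schmidt
   coefficients s_j, its partial transpose has trace norm (sum_j s_j)^2, and
   Cauchy-Schwarz over the d(d-1) pairs of distinct indices bounds the negativity
   (sum_j s_j)^2 - sum_j s_j^2 by sqrt (d(d-1)) sqrt ((tr sigma)^2 - tr sigma^2),
   sigma being either marginal of |M><M|.  The last square root is superadditive in
   sigma, and the marginals of the |M_i> sum to those of the state at time t1. *)
Require Import Defs.
From Stdlib Require Import ClassicalEpsilon.
From mathcomp Require Import all_boot all_order all_algebra.
From mathcomp Require Import reals.
From mathcomp Require Import complex mxtens.
From mathcomp Require Import ring lra.
Set Implicit Arguments.
Unset Strict Implicit.
Unset Printing Implicit Defensive.
Import Order.TTheory GRing.Theory Num.Theory.
Local Open Scope ring_scope.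
Local Open Scope complex_scope.

(** * Norm inequalities for finite families of reals *)

Section EuclideanNorm.
Variable R : rcfType.

Lemma sum_sqr_ge0 (I : finType) (a : I -> R) : 0 <= \sum_i a i ^+ 2.
Proof. by apply: sumr_ge0 => i _; exact: sqr_ge0. Qed.

Definition l2norm (I : finType) (a : I -> R) : R := Num.sqrt (\sum_i a i ^+ 2).

Lemma l2norm_ge0 (I : finType) (a : I -> R) : 0 <= l2norm a.
Proof. exact: sqrtr_ge0. Qed.

Lemma sqr_l2norm (I : finType) (a : I -> R) : l2norm a ^+ 2 = \sum_i a i ^+ 2.
Proof. by rewrite sqr_sqrtr // sum_sqr_ge0. Qed.

Lemma l2norm_eq0 (I : finType) (a : I -> R) : l2norm a = 0 -> forall i, a i = 0.
Proof.
move=> a0 i; have /eqP := sqr_l2norm a.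
rewrite a0 expr0n /= eq_sym psumr_eq0; last by move=> j _; exact: sqr_ge0.
by move/allP/(_ i); rewrite mem_index_enum sqrf_eq0 => /(_ isT) /eqP.
Qed.

Lemma cauchy_schwarz_l2norm (I : finType) (a b : I -> R) :
  \sum_i a i * b i <= l2norm a * l2norm b.
Proof.
have [a0|a0] := eqVneq (l2norm a) 0.
  by rewrite a0 mul0r big1 // => i _; rewrite (l2norm_eq0 a0) mul0r.
have [b0|b0] := eqVneq (l2norm b) 0.
  by rewrite b0 mulr0 big1 // => i _; rewrite (l2norm_eq0 b0) mulr0.
have ab_gt0 : 0 < l2norm a * l2norm b.
  by rewrite mulr_gt0 // lt_neqAle eq_sym ?a0 ?b0 l2norm_ge0.
have: 0 <= \sum_i (l2norm b * a i - l2norm a * b i) ^+ 2 by exact: sum_sqr_ge0.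
under eq_bigr => i _.
  have -> : (l2norm b * a i - l2norm a * b i) ^+ 2 = l2norm b ^+ 2 * a i ^+ 2
    + (l2norm a ^+ 2 * b i ^+ 2 - 2 * (l2norm a * l2norm b) * (a i * b i)).
    by ring.
  over.
rewrite big_split sumrB /= -!mulr_sumr -!sqr_l2norm.
move=> h; rewrite -(ler_pM2l ab_gt0); nra.
Qed.

(** Pair the total with itself: Cauchy-Schwarz applied to each summand bounds its squared norm by
    the sum of the norms times its own norm, which then cancels. *)
Lemma l2norm_sum (J I : finType) (a : J -> I -> R) :
  l2norm (fun i => \sum_j a j i) <= \sum_j l2norm (a j).
Proof.
set L := l2norm _.
have L_ge0 : 0 <= L := l2norm_ge0 _.
have [->|L0] := eqVneq L 0; first by apply: sumr_ge0 => j _; exact: l2norm_ge0.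
have L_gt0 : 0 < L by rewrite lt_neqAle eq_sym L0.
rewrite -(ler_pM2r L_gt0) -expr2 sqr_l2norm mulr_suml.
under eq_bigr => i _ do rewrite expr2 mulr_suml.
rewrite exchange_big /=; apply: ler_sum => j _.
exact: cauchy_schwarz_l2norm.
Qed.

(* The vectors (sqrt (t_j^2 - n_j^2), n_j) of the plane have norm t_j, so this is
   the triangle inequality in the plane. *)
Lemma sum_sqrt_subr_sqr (J : finType) (t n : J -> R) :
  (forall j, 0 <= n j <= t j) ->
  \sum_j Num.sqrt (t j ^+ 2 - n j ^+ 2)
    <= Num.sqrt ((\sum_j t j) ^+ 2 - (\sum_j n j) ^+ 2).
Proof.
move=> nt; have t_ge0 j : 0 <= t j by have /andP[/le_trans h /h] := nt j.
have d_ge0 j : 0 <= t j ^+ 2 - n j ^+ 2.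
  by rewrite subr_ge0; have := nt j; have := t_ge0 j; nra.
pose a j (b : bool) := if b then Num.sqrt (t j ^+ 2 - n j ^+ 2) else n j.
have := l2norm_sum a.
have -> : \sum_j l2norm (a j) = \sum_j t j.
  apply: eq_bigr => j _; rewrite /l2norm big_bool /= sqr_sqrtr //.
  by rewrite subrK sqrtr_sqr ger0_norm.
rewrite -(@ler_pXn2r _ 2) ?nnegrE ?l2norm_ge0 ?sumr_ge0 // sqr_l2norm big_bool /=.
move=> h; rewrite -[leLHS]ger0_norm; last by apply: sumr_ge0 => j _; exact: sqrtr_ge0.
by rewrite -sqrtr_sqr ler_wsqrtr // lerBrDr.
Qed.

Lemma sum_neq_pair (V : nmodType) (I : finType) (f : I -> I -> V) :
  \sum_i \sum_j f i j = \sum_i f i i + \sum_i \sum_(j | j != i) f i j.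
Proof. by rewrite -big_split; apply: eq_bigr => i _; rewrite (bigD1 i). Qed.

Lemma sqr_sum (I : finType) (s : I -> R) :
  (\sum_i s i) ^+ 2 = \sum_i s i ^+ 2 + \sum_i \sum_(j | j != i) s i * s j.
Proof.
rewrite expr2 mulr_suml; under eq_bigr => i _ do rewrite mulr_sumr.
by rewrite sum_neq_pair.
Qed.

(* The number d(d-1) of ordered pairs of distinct indices is where the
   normalisation of the negativity comes from. *)
Lemma sqr_sum_le (d : nat) (s : 'I_d -> R) :
  (\sum_i s i) ^+ 2 <= \sum_i s i ^+ 2 + Num.sqrt (d%:R * (d%:R - 1))
    * Num.sqrt ((\sum_i s i ^+ 2) ^+ 2 - \sum_i s i ^+ 4).
Proof.
have offdiag (f : 'I_d -> 'I_d -> R) : \sum_i \sum_(j | j != i) f i j =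
    \sum_(p : 'I_d * 'I_d) (p.2 != p.1)%:R * f p.1 p.2.
  rewrite -(pair_bigA _ (fun i j => (j != i)%:R * f i j)) /=.
  apply: eq_bigr => i _; rewrite [LHS]big_mkcond /=; apply: eq_bigr => j _.
  by case: (j != i); rewrite ?mul1r ?mul0r.
rewrite sqr_sum lerD2l offdiag.
have boolM (b : bool) : b%:R * b%:R = b%:R :> R by rewrite -natrM mulnb andbb.
(* Doubling the indicator of distinct indices puts a copy in both Cauchy-Schwarz factors: one then
   counts the pairs, the other stays restricted to them. *)
under eq_bigr => p _ do rewrite -boolM -mulrA.
apply: le_trans (cauchy_schwarz_l2norm _ _) _; rewrite /l2norm.
under eq_bigr => p _ do rewrite expr2 boolM -[_%:R]mulr1.
under [X in _ * Num.sqrt X <= _]eq_bigr => p _ do rewrite exprMn [_%:R ^+ 2]boolM exprMn.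
rewrite -(offdiag (fun _ _ => 1)) -(offdiag (fun i j => s i ^+ 2 * s j ^+ 2)).
have -> : \sum_(i < d) \sum_(j | j != i) 1 = d%:R * (d%:R - 1) :> R.
  have := sum_neq_pair (fun i j : 'I_d => 1 : R).
  rewrite !sumr_const card_ord -[_ *+ d *+ d]mulr_natl => h; lra.
rewrite [(\sum_i s i ^+ 2) ^+ 2]sqr_sum.
under [X in _ <= _ * Num.sqrt (X + _ - _)]eq_bigr => i _ do rewrite -exprM.
by rewrite addrAC subrr add0r.
Qed.

End EuclideanNorm.

Section Operators.
Variable R : realType.
Local Notation C := R[i].
Local Notation Re := complex.Re.
Local Notation Im := complex.Im.
Local Notation RC := (real_complex R).

(** * Real parts, conjugates and adjoints *)

Lemma ReD (x y : C) : Re (x + y) = Re x + Re y.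
Proof. by case: x y => [? ?] [? ?]. Qed.

Lemma ReN (x : C) : Re (- x) = - Re x.
Proof. by case: x. Qed.

Lemma Re_sum (I : Type) (r : seq I) (P : pred I) (f : I -> C) :
  Re (\sum_(i <- r | P i) f i) = \sum_(i <- r | P i) Re (f i).
Proof. by elim/big_rec2: _ => [|i x y _ <-]; rewrite ?ReD. Qed.

Lemma conjcD (x y : C) : conjc (x + y) = conjc x + conjc y.
Proof. exact: rmorphD. Qed.

Lemma conjcM (x y : C) : conjc (x * y) = conjc x * conjc y.
Proof. exact: rmorphM. Qed.

Lemma conjc_sum (I : Type) (r : seq I) (P : pred I) (f : I -> C) :
  conjc (\sum_(i <- r | P i) f i) = \sum_(i <- r | P i) conjc (f i).
Proof. by elim/big_rec2: _ => [|i x y _ <-]; rewrite ?conjc0 ?conjcD. Qed.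

Lemma Re_ge0 (x : C) : 0 <= x -> 0 <= Re x.
Proof. by rewrite lecE => /andP[]. Qed.

Lemma adjmxE m n (X : 'M[C]_(m, n)) i j : adjmx X i j = conjc (X j i).
Proof. by rewrite !mxE. Qed.

Lemma adjmxK m n (X : 'M[C]_(m, n)) : adjmx (adjmx X) = X.
Proof. by apply/matrixP => i j; rewrite !adjmxE conjcK. Qed.

Lemma adjmxM m n p (X : 'M[C]_(m, n)) (Y : 'M[C]_(n, p)) :
  adjmx (X *m Y) = adjmx Y *m adjmx X.
Proof. by rewrite /adjmx map_mxM trmx_mul. Qed.

Lemma adjmxD m n (X Y : 'M[C]_(m, n)) : adjmx (X + Y) = adjmx X + adjmx Y.
Proof. by apply/matrixP => i j; rewrite !(mxE, adjmxE) conjcD. Qed.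

Lemma adjmxN m n (X : 'M[C]_(m, n)) : adjmx (- X) = - adjmx X.
Proof. by apply/matrixP => i j; rewrite !(mxE, adjmxE) rmorphN. Qed.

Lemma adjmxZ m n (a : C) (X : 'M[C]_(m, n)) : adjmx (a *: X) = conjc a *: adjmx X.
Proof. by apply/matrixP => i j; rewrite !(mxE, adjmxE) conjcM. Qed.

Lemma adjmx_sum m n (I : Type) (r : seq I) (P : pred I) (F : I -> 'M[C]_(m, n)) :
  adjmx (\sum_(i <- r | P i) F i) = \sum_(i <- r | P i) adjmx (F i).
Proof.
apply: (big_morph _ (@adjmxD m n)).
by apply/matrixP => i j; rewrite adjmxE !mxE conjc0.
Qed.

Lemma adjmx_delta m n (i : 'I_m) (j : 'I_n) :
  adjmx (delta_mx i j : 'M[C]_(m, n)) = delta_mx j i.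
Proof.
apply/matrixP => a b; rewrite adjmxE !mxE andbC.
by case: (_ && _); rewrite ?conjc0 ?conjc1.
Qed.

Lemma adjmx_tr m n (X : 'M[C]_(m, n)) : adjmx X^T = (adjmx X)^T.
Proof. by apply/matrixP => i j; rewrite !(mxE, adjmxE). Qed.

Lemma adjmx_diag_real n (D : 'rV[R]_n) :
  adjmx (diag_mx (map_mx (real_complex R) D)) = diag_mx (map_mx (real_complex R) D).
Proof.
apply/matrixP => i j; rewrite !(mxE, adjmxE) eq_sym.
by case: eqP => [->|_]; rewrite ?mulr0n ?mulr1n ?conjc_real ?conjc0.
Qed.

(** * Vector norms, positive semidefinite matrices and the spectral theorem *)

Definition vnorm n (v : 'cV[C]_n) : R := Num.sqrt (Re ((adjmx v *m v) 0 0)).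

Lemma vnorm_ge0 n (v : 'cV[C]_n) : 0 <= vnorm v.
Proof. exact: sqrtr_ge0. Qed.

Lemma inner_self n (v : 'cV[C]_n) : (adjmx v *m v) 0 0 = \sum_i `|v i 0| ^+ 2.
Proof.
by rewrite mxE; apply: eq_bigr => i _; rewrite adjmxE sqr_normc mulrC.
Qed.

Lemma sqr_vnorm n (v : 'cV[C]_n) : ((vnorm v) ^+ 2)%:C = (adjmx v *m v) 0 0.
Proof.
have h : 0 <= (adjmx v *m v) 0 0.
  by rewrite inner_self sumr_ge0 // => i _; rewrite exprn_ge0.
by rewrite sqr_sqrtr ?Re_ge0 // RRe_real // ger0_real.
Qed.

Lemma inner_self_ge0 n (v : 'cV[C]_n) : 0 <= (adjmx v *m v) 0 0.
Proof. by rewrite -sqr_vnorm ler0c sqr_ge0. Qed.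

Lemma inner_self_eq0 n (v : 'cV[C]_n) : (adjmx v *m v) 0 0 = 0 -> v = 0.
Proof.
move/eqP; rewrite inner_self psumr_eq0; last by move=> i _; rewrite exprn_ge0.
move/allP => h; apply/matrixP => i j; rewrite ord1 mxE.
by have := h i (mem_index_enum _); rewrite sqrf_eq0 normr_eq0 => /eqP.
Qed.

Lemma vnorm_eq0 n (v : 'cV[C]_n) : vnorm v = 0 -> v = 0.
Proof.
by move=> v0; apply: inner_self_eq0; rewrite -sqr_vnorm v0 expr0n.
Qed.

Lemma psd0 n : psd (0 : 'M[C]_n).
Proof. by move=> v; rewrite mulmx0 mul0mx mxE. Qed.

Lemma psdD n (X Y : 'M[C]_n) : psd X -> psd Y -> psd (X + Y).
Proof.
by move=> pX pY v; rewrite mulmxDr mulmxDl mxE addr_ge0.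
Qed.

Lemma psdZ n (a : C) (X : 'M[C]_n) : 0 <= a -> psd X -> psd (a *: X).
Proof.
by move=> a_ge0 pX v; rewrite -scalemxAr -scalemxAl mxE mulr_ge0.
Qed.

Lemma psd_gram m n (X : 'M[C]_(m, n)) : psd (X *m adjmx X).
Proof.
move=> v; rewrite mulmxA -mulmxA -{1}(adjmxK X) -adjmxM; exact: inner_self_ge0.
Qed.

Lemma psd_conj m n (X : 'M[C]_n) (U : 'M[C]_(m, n)) :
  psd X -> psd (U *m X *m adjmx U).
Proof.
move=> pX v; have := pX (adjmx U *m v).
by rewrite adjmxM adjmxK !mulmxA.
Qed.

Lemma psd_tr n (X : 'M[C]_n) : psd X -> psd X^T.
Proof.
move=> pX v; have := pX (adjmx v)^T.
rewrite -adjmx_tr adjmxK.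
have -> : adjmx v *m X^T *m v = (v^T *m X *m adjmx v^T)^T.
  by rewrite !trmx_mul adjmx_tr !trmxK mulmxA.
by rewrite [X in _ -> 0 <= X]mxE.
Qed.

(** Polarization: the vectors [e i + c *: e j] with [c] equal to 1 and to the imaginary unit give
    enough linear equations to kill [Y i j] and [Y j i]. *)
Lemma quadratic_form_eq0 n (Y : 'M[C]_n) :
  (forall v : 'cV[C]_n, (adjmx v *m Y *m v) 0 0 = 0) -> Y = 0.
Proof.
move=> Y0; pose e k : 'cV[C]_n := delta_mx k 0.
have Ye k l : (adjmx (e k) *m Y *m e l) 0 0 = Y k l.
  by rewrite adjmx_delta -mulmxA -colE -rowE !mxE.
have Yd k : Y k k = 0 by rewrite -Ye.
have polar (c : C) i j : c * Y i j + conjc c * Y j i = 0.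
  have := Y0 (e i + c *: e j).
  rewrite adjmxD adjmxZ !mulmxDl !mulmxDr -!scalemxAl -!scalemxAr.
  have add11 (A B : 'M[C]_1) : (A + B) 0 0 = A 0 0 + B 0 0 by rewrite mxE.
  have scale11 a (A : 'M[C]_1) : (a *: A) 0 0 = a * A 0 0 by rewrite mxE.
  by rewrite add11 (add11 (_ *m _)) add11 !scale11 !Ye !Yd !mulr0 add0r addr0.
apply/matrixP => i j; rewrite mxE.
have := polar 1 i j; have := polar (0 +i* 1) i j.
case: (Y i j) (Y j i) => [a b] [c d] [h1 h2] [h3 h4].
by congr (_ +i* _); lra.
Qed.

(** In the order on complex numbers [0 <= z] forces [z] to be real, so the quadratic form of
    [adjmx X - X] vanishes. *)
Lemma psd_herm n (X : 'M[C]_n) : psd X -> adjmx X = X.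
Proof.
move=> pX; apply/eqP; rewrite -subr_eq0; apply/eqP/quadratic_form_eq0 => v.
have eX : (adjmx v *m adjmx X *m v) 0 0 = conjc ((adjmx v *m X *m v) 0 0).
  by rewrite -adjmxE !adjmxM adjmxK mulmxA.
rewrite mulmxBr mulmxBl mxE [X in _ + X]mxE eX.
have := pX v; rewrite lecE => /andP[/eqP /=].
by case: (_ 0 0) => a b /= -> _; rewrite oppr0 subrr.
Qed.

(** Restates the spectral theorem for normal matrices with eigenvalues typed as reals, so that
    absolute values and square roots can be taken in [R]. *)
Lemma herm_spectral n (X : 'M[C]_n) : adjmx X = X ->
  exists (U : 'M[C]_n) (D : 'rV[R]_n), [/\ U *m adjmx U = 1%:M,
    adjmx U *m U = 1%:M &
    X = adjmx U *m diag_mx (map_mx (real_complex R) D) *m U].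
Proof.
move=> hX.
have adjE m p (A : 'M[C]_(m, p)) : map_mx Num.conj A^T = adjmx A.
  by rewrite /adjmx map_trmx.
have hX' : X \is hermsymmx.
  by rewrite sesquiE expr0 scale1r; apply/eqP; rewrite adjE.
have /orthomx_spectralP eX := hermitian_normalmx hX'.
have D_real := hermitian_spectral_diag_real hX'.
have Uu := spectral_unitarymx X.
move: eX; rewrite (invmx_unitary Uu) adjE.
have /unitarymxP := Uu; rewrite adjE.
move: (spectralmx X) (spectral_diag X) D_real => U D /mxOverP D_real UU' eX.
exists U, (map_mx (@complex.Re R) D); split; [exact: UU' | exact: mulmx1C | ].
rewrite [LHS]eX; congr (_ *m diag_mx _ *m _); apply/rowP => i.
by rewrite mxE [X in _ = real_complex R X]mxE RRe_real.
Qed.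

(* As [msqrt] is only known through [epsilon], this stands in for the uniqueness of
   the positive square root. *)
Lemma psd_sqr_eigen n (P : 'M[C]_n) (u : 'cV[C]_n) (c : R) :
  psd P -> 0 <= c -> P *m (P *m u) = (c ^+ 2)%:C *: u -> P *m u = c%:C *: u.
Proof.
move=> pP c_ge0 PPu; have hP := psd_herm pP.
have [c0|c_gt0] := eqVneq c 0.
  rewrite c0 scale0r; apply: inner_self_eq0.
  by rewrite adjmxM hP -mulmxA PPu c0 expr0n scale0r mulmx0 mxE.
(* Since [P ^ 2 - c ^ 2] factors, [P] multiplies [w] by [- c]; as [c] is positive here, positivity
   of [P] forces [w = 0]. *)
pose w := P *m u - c%:C *: u; apply/eqP; rewrite -subr_eq0 -/w.
have Pw : P *m w = - c%:C *: w.
  by rewrite mulmxBr PPu -scalemxAr scalerBr scalerA mulNr !scaleNr opprK addrC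
    rmorphXn expr2.
have := pP w; rewrite -mulmxA Pw -scalemxAr mxE -sqr_vnorm mulNr -rmorphM.
rewrite -rmorphN ler0c oppr_ge0 pmulr_rle0; last by rewrite lt_neqAle eq_sym c_gt0.
move=> w0; apply/eqP/vnorm_eq0/eqP; rewrite -sqrf_eq0.
by rewrite eq_le w0 sqr_ge0.
Qed.

(** * Upper bounds on the trace norm *)

Lemma col_mulmx m n p (A : 'M[C]_(m, n)) (B : 'M[C]_(n, p)) k :
  col k (A *m B) = A *m col k B.
Proof. by rewrite !colE mulmxA. Qed.

Lemma psd_diag n (D : 'rV[R]_n) :
  (forall i, 0 <= D 0 i) -> psd (diag_mx (map_mx RC D)).
Proof.
move=> D_ge0; have := psd_gram (diag_mx (map_mx RC (map_mx Num.sqrt D))).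
rewrite adjmx_diag_real mulmx_diag; congr (psd (diag_mx _)).
by apply/rowP => i; rewrite !mxE -rmorphM -expr2 sqr_sqrtr.
Qed.

(* An upper bound on the trace norm of a Hermitian matrix in a form that is plainly
   preserved by sums and by positive trace-preserving maps. *)
Definition trnorm_bound n (X : 'M[C]_n) (r : R) :=
  exists A B : 'M[C]_n, [/\ psd A, psd B, X = A - B & Re (\tr A + \tr B) <= r].

(** Both traces are computed in an orthonormal eigenbasis [u k] of [X]. There [msqrt] has
    eigenvalues [|D 0 k|], and each is at most the sum of the expectations of [A] and [B] in [u k],
    since [X = A - B]. *)
Lemma trnorm_boundP n (X : 'M[C]_n) r : trnorm_bound X r -> trnorm X <= r.
Proof.
move=> [A [B [pA pB eX ABr]]].
have hX : adjmx X = X by rewrite eX adjmxD adjmxN !psd_herm.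
have [U [D [UU' U'U eXD]]] := herm_spectral hX.
have [pP PP] : psd (msqrt (adjmx X *m X)) /\
    msqrt (adjmx X *m X) *m msqrt (adjmx X *m X) = X *m X.
  rewrite hX /msqrt.
  apply: (epsilon_spec _ (fun P : 'M[C]_n => psd P /\ P *m P = X *m X)).
  (* The [epsilon] in [msqrt] says something only once a root is known to exist; the absolute value
     of [X] is one. *)
  exists (adjmx U *m diag_mx (map_mx RC (map_mx Num.norm D)) *m U); split.
    have pD : psd (diag_mx (map_mx RC (map_mx Num.norm D))).
      by apply: psd_diag => i; rewrite mxE normr_ge0.
    by have := psd_conj (adjmx U) pD; rewrite adjmxK.
  rewrite eXD !mulmxA -2!(mulmxA (_ *m _) U) UU' !mulmx1.
  rewrite -2!(mulmxA (adjmx U) (diag_mx _)) !mulmx_diag.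
  congr (_ *m diag_mx _ *m _); apply/rowP => i; rewrite !mxE -!rmorphM -expr2.
  by rewrite real_normK ?num_real // expr2.
rewrite /trnorm; set P := msqrt _ in pP PP *.
pose u k := col k (adjmx U).
have uE k i : u k i 0 = conjc (U k i) by rewrite mxE adjmxE.
have tr_u (Y : 'M[C]_n) : \tr Y = \sum_k (adjmx (u k) *m Y *m u k) 0 0.
  rewrite -{1}[Y]mulmx1 -{1}U'U mulmxA mxtrace_mulC mulmxA; apply: eq_bigr => k _.
  have -> : adjmx (u k) = row k U.
    by apply/rowP => i; rewrite adjmxE uE conjcK mxE.
  by rewrite -!row_mul /u -col_mulmx !mxE.
have u1 k : (adjmx (u k) *m u k) 0 0 = 1.
  have /matrixP/(_ k k) := UU'; rewrite mxE [RHS]mxE eqxx /= mulr1n => <-.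
  by rewrite mxE; apply: eq_bigr => i _; rewrite !adjmxE uE conjcK.
have Xu k : X *m u k = (D 0 k)%:C *: u k.
  rewrite -col_mulmx eXD -[_ *m _ *m U *m _]mulmxA UU' mulmx1.
  by apply/colP => i; rewrite mul_mx_diag !mxE mulrC.
have Pu k : P *m u k = (`|D 0 k|)%:C *: u k.
  apply: psd_sqr_eigen => //.
  rewrite mulmxA PP -mulmxA Xu -scalemxAr Xu scalerA -rmorphM -expr2.
  by rewrite real_normK ?num_real.
apply: le_trans ABr; rewrite !tr_u ReD !Re_sum -big_split /=.
apply: ler_sum => k _; rewrite -mulmxA Pu -scalemxAr mxE u1 mulr1 /=.
have -> : D 0 k = Re ((adjmx (u k) *m X *m u k) 0 0).
  by rewrite -mulmxA Xu -scalemxAr mxE u1 mulr1.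
rewrite eX mulmxBr mulmxBl mxE [X in _ + X]mxE ReD ReN.
apply: le_trans (ler_normB _ _) _; rewrite !ger0_norm // Re_ge0 //.
Qed.

Lemma trnorm_bound_le n (X : 'M[C]_n) r s :
  r <= s -> trnorm_bound X r -> trnorm_bound X s.
Proof.
move=> rs [A [B [pA pB eX ABr]]]; exists A, B; split=> //; exact: le_trans rs.
Qed.

Lemma trnorm_boundD n (X Y : 'M[C]_n) r s :
  trnorm_bound X r -> trnorm_bound Y s -> trnorm_bound (X + Y) (r + s).
Proof.
move=> [A [B [pA pB -> ABr]]] [A' [B' [pA' pB' -> ABs]]].
exists (A + A'), (B + B'); split; [exact: psdD | exact: psdD | | ].
  by rewrite opprD addrACA.
by rewrite !mxtraceD addrACA ReD lerD.
Qed.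

Lemma trnorm_bound_sum n (I : finType) (F : I -> 'M[C]_n) (r : I -> R) :
  (forall i, trnorm_bound (F i) (r i)) ->
  trnorm_bound (\sum_i F i) (\sum_i r i).
Proof.
move=> Fr; elim/big_rec2: _ => [|i s Y _ Ys]; last exact: trnorm_boundD.
by exists 0, 0; split; rewrite ?subrr ?raddf0 ?addr0 //; exact: psd0.
Qed.

Lemma trnorm_bound_tr n (X : 'M[C]_n) r :
  trnorm_bound X r -> trnorm_bound X^T r.
Proof.
move=> [A [B [pA pB -> ABr]]]; exists A^T, B^T.
by rewrite !mxtrace_tr; split=> //; [exact: psd_tr | exact: psd_tr | rewrite raddfB].
Qed.

Lemma tr_outer n (u v : 'cV[C]_n) : \tr (u *m adjmx v) = (adjmx v *m u) 0 0.
Proof. by rewrite mxtrace_mulC /mxtrace big_ord1. Qed.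

(* For nonzero [u], [v], with [a = |u|] and [b = |v|]:
   2ab (u v* + v u* ) = (b u + a v)(b u + a v)* - (b u - a v)(b u - a v)*. *)
Lemma trnorm_bound_outer n (u v : 'cV[C]_n) :
  trnorm_bound ((2^-1)%:C *: (u *m adjmx v + v *m adjmx u)) (vnorm u * vnorm v).
Proof.
have zero : trnorm_bound (0 : 'M[C]_n) 0.
  by exists 0, 0; split; rewrite ?subrr ?raddf0 ?addr0 //; exact: psd0.
have adj0 : adjmx (0 : 'cV[C]_n) = 0.
  by apply/matrixP => i j; rewrite adjmxE !mxE conjc0.
have [u0|u0] := eqVneq (vnorm u) 0.
  by rewrite u0 mul0r (vnorm_eq0 u0) adj0 mul0mx mulmx0 addr0 scaler0.
have [v0|v0] := eqVneq (vnorm v) 0.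
  by rewrite v0 mulr0 (vnorm_eq0 v0) adj0 mul0mx mulmx0 addr0 scaler0.
have tr_u := tr_outer u u; have tr_v := tr_outer v v.
move: tr_u tr_v; rewrite -!sqr_vnorm.
have := vnorm_ge0 v; have := vnorm_ge0 u; move: u0 v0.
move: (vnorm u) (vnorm v) => a b a0 b0 a_ge0 b_ge0 tr_u tr_v.
(* The factor 1/2 of the goal divided by the [2 * a * b] of the identity. *)
pose c := (4 * a * b)^-1.
have c_ge0 : 0 <= c%:C by rewrite ler0c invr_ge0 !mulr_ge0.
have c4ab : 2^-1 = c * (2 * a * b) by rewrite /c; field; rewrite a0 b0.
have outerE (x y : 'cV[C]_n) i j : (x *m adjmx y) i j = x i 0 * conjc (y j 0).
  by rewrite mxE big_ord1 adjmxE.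
pose w (s : R) := b%:C *: u + s%:C *: (a%:C *: v).
have wE s i : w s i 0 = b%:C * u i 0 + s%:C * (a%:C * v i 0) by rewrite !mxE.
have outer_wE s i j : (c%:C *: (w s *m adjmx (w s))) i j =
    c%:C * (b%:C * u i 0 + s%:C * (a%:C * v i 0))
         * (b%:C * conjc (u j 0) + s%:C * (a%:C * conjc (v j 0))).
  by rewrite mxE outerE !wE !(conjcD, conjcM, conjc_real) mulrA.
have outerZE (x y : 'cV[C]_n) k i j : (k *: (x *m adjmx y)) i j = k * (x i 0 * conjc (y j 0)).
  by rewrite mxE outerE.
exists (c%:C *: (w 1 *m adjmx (w 1))), (c%:C *: (w (-1) *m adjmx (w (-1)))).
split; [exact/psdZ/psd_gram | exact/psdZ/psd_gram | | ].
  apply/matrixP => i j; rewrite scalerDr mxE !outerZE mxE outer_wE mxE outer_wE.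
  rewrite c4ab !(rmorphM, rmorphN, rmorph1) /=; ring.
rewrite -mxtraceD.
(* In the sum the cross terms cancel; the remaining trace is [4 * c * a ^+ 2 * b ^+ 2 = a * b]. *)
have -> : c%:C *: (w 1 *m adjmx (w 1)) + c%:C *: (w (-1) *m adjmx (w (-1))) =
    (2 * c * b ^+ 2)%:C *: (u *m adjmx u) + (2 * c * a ^+ 2)%:C *: (v *m adjmx v).
  apply/matrixP => i j; rewrite [LHS]mxE.
  rewrite [X in X + _ = _]outer_wE.
  rewrite [X in _ + X = _]outer_wE.
  rewrite [RHS]mxE (outerZE u) (outerZE v) !expr2.
  rewrite !(rmorphM, rmorphN, rmorph1) /=; ring.
rewrite mxtraceD !mxtraceZ tr_u tr_v -!rmorphM -rmorphD /=.
have -> : 2 * c * b ^+ 2 * a ^+ 2 + 2 * c * a ^+ 2 * b ^+ 2 =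
    2 * (c * (2 * a * b)) * (a * b) by ring.
by rewrite -c4ab mulfV ?mul1r // pnatr_eq0.
Qed.


Lemma psd_factor n (X : 'M[C]_n) : psd X -> exists V : 'M[C]_n, X = V *m adjmx V.
Proof.
move=> pX; have [U [D [UU' U'U eX]]] := herm_spectral (psd_herm pX).
(* The eigenvalues are the diagonal entries of the conjugate of [X] by [U], which is again
   positive. *)
have D_ge0 i : 0 <= D 0 i.
  have := psd_conj U pX; rewrite eX !mulmxA UU' mul1mx -mulmxA UU' mulmx1.
  move=> /(_ (delta_mx i 0)).
  by rewrite adjmx_delta -mulmxA -colE -rowE !mxE eqxx /= ler0c.
exists (adjmx U *m diag_mx (map_mx RC (map_mx Num.sqrt D))).
rewrite adjmxM adjmxK adjmx_diag_real mulmxA -(mulmxA (adjmx U)) mulmx_diag.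
rewrite {1}eX; congr (_ *m diag_mx _ *m _); apply/rowP => i.
by rewrite !mxE -rmorphM -expr2 sqr_sqrtr.
Qed.

(** * Bipartite operators: blocks, partial transposes, marginals, Schmidt form *)

Lemma biS d e (i : 'I_d) (a : 'I_e) : bS (bi i a) = i.
Proof. by rewrite /bS /bi mxtens_indexK. Qed.

Lemma biA d e (i : 'I_d) (a : 'I_e) : bA (bi i a) = a.
Proof. by rewrite /bA /bi mxtens_indexK. Qed.

Lemma biK d e (p : 'I_(d * e)) : bi (bS p) (bA p) = p.
Proof.
by rewrite /bi /bS /bA -surjective_pairing mxtens_unindexK.
Qed.

Lemma sum_bi (V : nmodType) d e (f : 'I_(d * e) -> V) :
  \sum_p f p = \sum_i \sum_a f (bi i a).
Proof.
rewrite (pair_bigA _ (fun i a => f (bi i a))) /=.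
rewrite (reindex (fun x : 'I_d * 'I_e => bi x.1 x.2)) //=.
exists (fun p => (bS p, bA p)) => [[i a]|p] _ /=; first by rewrite biS biA.
exact: biK.
Qed.

Lemma ampl_linear d e (Phi : 'M[C]_d -> 'M[C]_d) :
  (forall (c : C) (X Y : 'M[C]_d), Phi (c *: X + Y) = c *: Phi X + Phi Y) ->
  forall (c : C) (X Y : 'M[C]_(d * e)),
    ampl Phi (c *: X + Y) = c *: ampl Phi X + ampl Phi Y.
Proof.
move=> lin c X Y; apply/matrixP => p q; rewrite !mxE.
set L := \matrix_(i, j) (c *: X + Y) _ _.
have -> : L = c *: (\matrix_(i, j) X (bi i (bA p)) (bi j (bA q)))
    + \matrix_(i, j) Y (bi i (bA p)) (bi j (bA q)).
  by apply/matrixP => i j; rewrite !mxE.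
by rewrite lin !mxE.
Qed.

Lemma mx_linear_sum n m (L : 'M[C]_n -> 'M[C]_m) :
  (forall (c : C) (X Y : 'M[C]_n), L (c *: X + Y) = c *: L X + L Y) ->
  forall (I : Type) (r : seq I) (P : pred I) (F : I -> 'M[C]_n),
    L (\sum_(i <- r | P i) F i) = \sum_(i <- r | P i) L (F i).
Proof.
move=> lin I r P F.
have L0 : L 0 = 0.
  by have := lin (-1) 0 0; rewrite scaler0 addr0 scaleN1r addNr.
elim/big_rec2: _ => [//|i X Y _ <-].
by have := lin 1 (F i) Y; rewrite !scale1r.
Qed.

Lemma tr_ampl d e (Phi : 'M[C]_d -> 'M[C]_d) (X : 'M[C]_(d * e)) :
  (forall Y, \tr (Phi Y) = \tr Y) -> \tr (ampl Phi X) = \tr X.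
Proof.
move=> trPhi; rewrite /mxtrace !sum_bi exchange_big [RHS]exchange_big /=.
apply: eq_bigr => a _.
have := trPhi (\matrix_(i, j) X (bi i a) (bi j a)); rewrite /mxtrace.
under [X in _ = X -> _]eq_bigr => i _ do rewrite mxE.
by move=> <-; apply: eq_bigr => i _; rewrite mxE biS biA.
Qed.

(** Complete positivity keeps both parts of the splitting positive, and trace preservation keeps
    their traces. *)
Lemma trnorm_bound_ampl d e (Phi : 'M[C]_d -> 'M[C]_d) (X : 'M[C]_(d * e)) r :
  CPT Phi -> trnorm_bound X r -> trnorm_bound (ampl Phi X) r.
Proof.
move=> [lin cp tp] [A [B [pA pB -> ABr]]].
exists (ampl Phi A), (ampl Phi B); rewrite !tr_ampl //.
split; [exact: cp | exact: cp | | exact: ABr].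
rewrite -[A - B]addrC -scaleN1r ampl_linear // scaleN1r addrC //.
Qed.

(** [ampl Phi] acts separately on the blocks labelled by a pair of ancilla indices, and [ptransA]
    only permutes these blocks. *)
Lemma ptransA_ampl d e (Phi : 'M[C]_d -> 'M[C]_d) (X : 'M[C]_(d * e)) :
  ptransA (ampl Phi X) = ampl Phi (ptransA X).
Proof.
apply/matrixP => p q; rewrite !mxE !biS !biA; congr (Phi _ _ _).
by apply/matrixP => i j; rewrite !mxE !biS !biA.
Qed.

(** Reduces transposition on the system to that on the ancilla, the one shown to commute with
    [ampl Phi]. *)
Lemma ptransS_tr d e (X : 'M[C]_(d * e)) : ptransS X = (ptransA X)^T.
Proof. by apply/matrixP => p q; rewrite !mxE. Qed.

Lemma ptransA_sum d e (I : finType) (F : I -> 'M[C]_(d * e)) :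
  ptransA (\sum_i F i) = \sum_i ptransA (F i).
Proof.
apply/matrixP => p q; rewrite mxE !summxE.
by apply: eq_bigr => i _; rewrite mxE.
Qed.

Lemma ptrA_sum d e (I : finType) (F : I -> 'M[C]_(d * e)) :
  ptrA (\sum_i F i) = \sum_i ptrA (F i).
Proof.
apply/matrixP => j k; rewrite mxE !summxE.
under [RHS]eq_bigr => i _ do rewrite mxE.
by rewrite exchange_big; apply: eq_bigr => a _; rewrite summxE.
Qed.

Lemma ptrS_sum d e (I : finType) (F : I -> 'M[C]_(d * e)) :
  ptrS (\sum_i F i) = \sum_i ptrS (F i).
Proof.
apply/matrixP => j k; rewrite mxE !summxE.
under [RHS]eq_bigr => i _ do rewrite mxE.
by rewrite exchange_big; apply: eq_bigr => a _; rewrite summxE.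
Qed.

(* The rank-one operator |M><M|, where the coefficient matrix [M] stands for the
   vector sum_(i, a) M i a |i>|a>. *)
Definition pure d e (M : 'M[C]_(d, e)) : 'M[C]_(d * e) :=
  \matrix_(p, q) (M (bS p) (bA p) * conjc (M (bS q) (bA q))).

(** The columns of a factor [V] of [X], reshaped into [d] by [e] matrices, are the unnormalized pure
    states. *)
Lemma psd_sum_pure d e (X : 'M[C]_(d * e)) :
  psd X -> exists M : 'I_(d * e) -> 'M[C]_(d, e), X = \sum_k pure (M k).
Proof.
move=> /psd_factor[V ->]; exists (fun k => \matrix_(i, a) V (bi i a) k).
apply/matrixP => p q; rewrite mxE summxE; apply: eq_bigr => k _.
by rewrite adjmxE !mxE !biK.
Qed.

(** Each ancilla block of [pure M] is the outer product of two columns of [M], and [K] acts on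
    columns. *)
Lemma ampl_kraus_pure d e (K : 'M[C]_d) (M : 'M[C]_(d, e)) :
  ampl (fun rho => K *m rho *m adjmx K) (pure M) = pure (K *m M).
Proof.
apply/matrixP => p q; rewrite mxE [RHS]mxE.
have -> : \matrix_(i, j) pure M (bi i (bA p)) (bi j (bA q)) =
    col (bA p) M *m adjmx (col (bA q) M).
  by apply/matrixP => i j; rewrite !mxE big_ord1 !mxE !biS !biA.
rewrite mulmxA -col_mulmx -mulmxA -adjmxM -col_mulmx mxE big_ord1 adjmxE.
by rewrite !mxE.
Qed.

Lemma ptrA_pure d e (M : 'M[C]_(d, e)) : ptrA (pure M) = M *m adjmx M.
Proof.
apply/matrixP => i j; rewrite !mxE; apply: eq_bigr => a _.
by rewrite mxE !biS !biA !mxE.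
Qed.

Lemma ptrS_pure d e (M : 'M[C]_(d, e)) : ptrS (pure M) = (adjmx M *m M)^T.
Proof.
apply/matrixP => a b; rewrite !mxE; apply: eq_bigr => i _.
by rewrite mxE !biS !biA !mxE mulrC.
Qed.

Lemma tr_pure d e (M : 'M[C]_(d, e)) : \tr (pure M) = \tr (M *m adjmx M).
Proof.
rewrite /mxtrace sum_bi; apply: eq_bigr => i _; rewrite mxE.
by apply: eq_bigr => a _; rewrite mxE !biS !biA adjmxE.
Qed.

(** Diagonalizing [M *m adjmx M] by [U] makes the rows of [N = U *m M] orthogonal with norms [s i].
    They are left unnormalized, which avoids dividing by a vanishing Schmidt coefficient. *)
Lemma schmidt_decomposition d e (M : 'M[C]_(d, e)) :
  exists (U : 'M[C]_d) (s : 'I_d -> R) (N : 'M[C]_(d, e)),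
  [/\ U *m adjmx U = 1%:M, adjmx U *m U = 1%:M, forall i, 0 <= s i, M = adjmx U *m N &
    N *m adjmx N = diag_mx (\row_i (s i ^+ 2)%:C)].
Proof.
have pM := psd_gram M.
have [U [D [UU' U'U eX]]] := herm_spectral (psd_herm pM).
have ND : (U *m M) *m adjmx (U *m M) = diag_mx (map_mx RC D).
  by rewrite adjmxM mulmxA -(mulmxA U) eX !mulmxA UU' mul1mx -mulmxA UU' mulmx1.
exists U, (fun i => Num.sqrt (D 0 i)), (U *m M); split=> //.
- by move=> i; exact: sqrtr_ge0.
- by rewrite mulmxA U'U mul1mx.
rewrite ND; congr diag_mx; apply/rowP => i; rewrite !mxE sqr_sqrtr //.
have /matrixP/(_ i i) := ND; rewrite [RHS]mxE eqxx mulr1n mxE [RHS]mxE => h.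
rewrite -ler0c -h sumr_ge0 // => a _; rewrite adjmxE; exact: mulcJ_ge0.
Qed.

(** * The Frobenius norm *)

Definition fronorm n (X : 'M[C]_n) : R :=
  l2norm (fun x : 'I_n * 'I_n * bool =>
    if x.2 then Re (X x.1.1 x.1.2) else Im (X x.1.1 x.1.2)).

Lemma Im_sum (I : Type) (r : seq I) (P : pred I) (f : I -> C) :
  Im (\sum_(i <- r | P i) f i) = \sum_(i <- r | P i) Im (f i).
Proof.
elim/big_rec2: _ => [//|i x y _ <-].
by case: (f i) y => [a b] [a' b'].
Qed.

(** With real and imaginary parts as separate real coordinates, this is the triangle inequality for
    [l2norm]. *)
Lemma fronorm_sum n (I : finType) (F : I -> 'M[C]_n) :
  fronorm (\sum_i F i) <= \sum_i fronorm (F i).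
Proof.
have -> : fronorm (\sum_i F i) = l2norm (fun x : 'I_n * 'I_n * bool =>
    \sum_i if x.2 then Re (F i x.1.1 x.1.2) else Im (F i x.1.1 x.1.2)).
  congr (Num.sqrt _); apply: eq_bigr => -[[j k] b] _ /=.
  by congr (_ ^+ 2); case: b; rewrite summxE ?Re_sum ?Im_sum.
exact: l2norm_sum.
Qed.

Lemma sqr_fronorm n (X : 'M[C]_n) :
  adjmx X = X -> fronorm X ^+ 2 = Re (\tr (X *m X)).
Proof.
move=> hX; rewrite sqr_l2norm Re_sum.
rewrite -(pair_bigA _ (fun jk b => (if b then Re (X jk.1 jk.2) else Im (X jk.1 jk.2)) ^+ 2)).
rewrite -(pair_bigA _ (fun j k => \sum_b (if b then Re (X j k) else Im (X j k)) ^+ 2)) /=.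
apply: eq_bigr => j _; rewrite mxE Re_sum; apply: eq_bigr => k _.
rewrite big_bool /= -{4}hX adjmxE; case: (X j k) => a b /=.
by rewrite mulrN opprK !expr2.
Qed.

(** * Negativity and linear entropy of pure states *)

Lemma vnorm_outer_conj d e (U : 'M[C]_d) (N : 'M[C]_(d, e)) (s : 'I_d -> R) j k :
  U *m adjmx U = 1%:M -> N *m adjmx N = diag_mx (\row_i (s i ^+ 2)%:C) ->
  0 <= s k ->
  vnorm (\col_p (conjc (U j (bS p)) * conjc (N k (bA p))) : 'cV[C]_(d * e)) = s k.
Proof.
move=> UU' NN' s_ge0; rewrite /vnorm.
(* A product vector: its squared norm is a product of diagonal entries of two Gram matrices. *)
have -> : (adjmx (\col_p (conjc (U j (bS p)) * conjc (N k (bA p))))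
    *m \col_p (conjc (U j (bS p)) * conjc (N k (bA p))) : 'M[C]_1) 0 0
    = (U *m adjmx U) j j * (N *m adjmx N) k k.
  rewrite mxE sum_bi [(U *m _) j j]mxE [(N *m _) k k]mxE mulr_suml.
  apply: eq_bigr => i _; rewrite mulr_sumr; apply: eq_bigr => a _.
  rewrite !adjmxE mxE biS biA conjcM !conjcK.
  ring.
rewrite UU' NN' [1%:M j j]mxE eqxx mul1r mxE eqxx mulr1n mxE /=.
by rewrite sqrtr_sqr ger0_norm.
Qed.

Definition purity d e (M : 'M[C]_(d, e)) : R :=
  Re (\tr (M *m adjmx M *m (M *m adjmx M))).

Lemma trnorm_bound_pure d e (M : 'M[C]_(d, e)) :
  [/\ 0 <= Re (\tr (M *m adjmx M)),
    0 <= purity M <= Re (\tr (M *m adjmx M)) ^+ 2 &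
    trnorm_bound (ptransA (pure M)) (Re (\tr (M *m adjmx M)) +
      Num.sqrt (d%:R * (d%:R - 1)) *
      Num.sqrt (Re (\tr (M *m adjmx M)) ^+ 2 - purity M))].
Proof.
have [U [s [N [UU' U'U s_ge0 eM NN']]]] := schmidt_decomposition M.
have eMM : M *m adjmx M = adjmx U *m diag_mx (\row_i (s i ^+ 2)%:C) *m U.
  by rewrite eM adjmxM adjmxK -NN' !mulmxA.
have et : Re (\tr (M *m adjmx M)) = \sum_i s i ^+ 2.
  rewrite eMM mxtrace_mulC mulmxA UU' mul1mx mxtrace_diag Re_sum.
  by apply: eq_bigr => i _; rewrite mxE.
have eq : purity M = \sum_i s i ^+ 4.
  rewrite /purity eMM !mulmxA -(mulmxA _ U (adjmx U)) UU' mulmx1 mxtrace_mulC.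
  rewrite !mulmxA UU' mul1mx mulmx_diag mxtrace_diag Re_sum.
  by apply: eq_bigr => i _; rewrite !mxE -rmorphM /=; ring.
have s2_ge0 i : 0 <= s i ^+ 2 by exact: sqr_ge0.
rewrite et eq; split; first exact: sum_sqr_ge0.
  rewrite sqr_sum; under [X in _ <= X + _]eq_bigr => i _ do rewrite -exprM.
  rewrite sumr_ge0 => [|i _]; last by rewrite exprn_ge0.
  rewrite lerDl sumr_ge0 // => i _; apply: sumr_ge0 => j _.
  exact: mulr_ge0.
(* This leaves the bound by the squared sum of the Schmidt coefficients. *)
apply: trnorm_bound_le (sqr_sum_le s) _.
pose y j k : 'cV[C]_(d * e) := \col_p (conjc (U j (bS p)) * conjc (N k (bA p))).
have y_norm j k : vnorm (y j k) = s k by exact: vnorm_outer_conj.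
(* Partial transposition swaps the ancilla factors of the Schmidt terms [j] and [k], so each outer
   product pairs [y j k] with [y k j]. *)
have eX : ptransA (pure M) = \sum_j \sum_k y j k *m adjmx (y k j).
  apply/matrixP => p q; rewrite mxE mxE !biS !biA eM.
  rewrite mxE [X in _ * conjc X]mxE conjc_sum mulr_suml summxE.
  apply: eq_bigr => j _; rewrite mulr_sumr summxE; apply: eq_bigr => k _.
  rewrite !adjmxE mxE big_ord1 adjmxE mxE [y k j q 0]mxE !conjcM !conjcK.
  ring.
(* Averaging with the sum reindexed by swapping [j] and [k] makes every term Hermitian, as
   [trnorm_bound] requires. *)
have -> : ptransA (pure M) = \sum_(x : 'I_d * 'I_d) (2^-1)%:C *:
    (y x.1 x.2 *m adjmx (y x.2 x.1) + y x.2 x.1 *m adjmx (y x.1 x.2)).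
  rewrite -(pair_bigA _ (fun j k => (2^-1)%:C *:
    (y j k *m adjmx (y k j) + y k j *m adjmx (y j k)))) /=.
  under eq_bigr => j _ do rewrite -scaler_sumr big_split.
  rewrite -scaler_sumr big_split /= [X in _ + X]exchange_big /= -eX.
  rewrite -[X in X + X]scale1r -scalerDl scalerA.
  have -> : (2^-1)%:C * (1 + 1) = 1 :> C.
    have -> : 1 + 1 = 2%:C :> C by rewrite rmorphD rmorph1.
    by rewrite -rmorphM mulVf ?pnatr_eq0.
  by rewrite scale1r.
have -> : (\sum_i s i) ^+ 2 =
    \sum_(x : 'I_d * 'I_d) vnorm (y x.1 x.2) * vnorm (y x.2 x.1).
  rewrite -(pair_bigA _ (fun j k => vnorm (y j k) * vnorm (y k j))) /= expr2 mulr_suml.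
  apply: eq_bigr => j _; rewrite mulr_sumr; apply: eq_bigr => k _.
  by rewrite !y_norm mulrC.
by apply: trnorm_bound_sum => x; exact: trnorm_bound_outer.
Qed.

(** [H i] stands for either marginal of the pure state [M i]. Its Frobenius norm is the root of the
    purity, so [sum_sqrt_subr_sqr] collects the summands and the triangle inequality for [fronorm]
    passes to the total marginal. *)
Lemma negativity_le_linear_entropy d n (I : finType) (M : I -> 'M[C]_d)
    (H : I -> 'M[C]_n) :
  \sum_i Re (\tr (M i *m adjmx (M i))) = 1 ->
  (forall i, adjmx (H i) = H i) ->
  (forall i, Re (\tr (H i *m H i)) = purity (M i)) ->
  \sum_i (Num.sqrt (Re (\tr (M i *m adjmx (M i))) ^+ 2 - purity (M i)))
  <= Num.sqrt (1 - Re (\tr ((\sum_i H i) *m (\sum_i H i)))).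
Proof.
move=> t1 hH eH; have b i := trnorm_bound_pure (M i).
have fro_sqr i : fronorm (H i) ^+ 2 = purity (M i) by rewrite sqr_fronorm.
under eq_bigr => i _ do rewrite -fro_sqr.
have fro_le i : 0 <= fronorm (H i) <= Re (\tr (M i *m adjmx (M i))).
  rewrite l2norm_ge0 -(@ler_pXn2r _ 2) ?nnegrE ?l2norm_ge0 ?fro_sqr //.
    by have [_ /andP[]] := b i.
  by have [] := b i.
apply: le_trans (sum_sqrt_subr_sqr fro_le) _.
rewrite t1 expr1n ler_wsqrtr // lerD2l lerN2 -sqr_fronorm; last first.
  by rewrite adjmx_sum; apply: eq_bigr => i _.
rewrite ler_pXn2r ?nnegrE ?l2norm_ge0 ?fronorm_sum // sumr_ge0 // => i _.
exact: l2norm_ge0.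
Qed.

(** * From a classical-memory realization to the inequality *)

Lemma ampl_sum_comp d e (I : finType) (E : 'M[C]_d -> 'M[C]_d)
    (Phi Psi : I -> 'M[C]_d -> 'M[C]_d) (X : 'M[C]_(d * e)) :
  (forall rho, E rho = \sum_i Phi i (Psi i rho)) ->
  ampl E X = \sum_i ampl (Phi i) (ampl (Psi i) X).
Proof.
move=> eE; apply/matrixP => p q; rewrite mxE eE !summxE; apply: eq_bigr => i _.
rewrite mxE; congr (Phi i _ _ _).
by apply/matrixP => j k; rewrite [RHS]mxE [RHS]mxE !biS !biA.
Qed.

Lemma kraus_linear d (K : 'M[C]_d) (c : C) (X Y : 'M[C]_d) :
  K *m (c *: X + Y) *m adjmx K = c *: (K *m X *m adjmx K) + K *m Y *m adjmx K.
Proof. by rewrite mulmxDr mulmxDl -scalemxAr -scalemxAl. Qed.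

Lemma classical_memory_unravelling d (E1 E2 : 'M[C]_d -> 'M[C]_d) (rho0 : 'M[C]_(d * d)) :
  classical_memory E1 E2 -> psd rho0 ->
  exists (I : finType) (M : I -> 'M[C]_d) (Phi : I -> 'M[C]_d -> 'M[C]_d),
    [/\ forall i, CPT (Phi i), ampl E1 rho0 = \sum_i pure (M i) &
      ampl E2 rho0 = \sum_i ampl (Phi i) (pure (M i))].
Proof.
move=> [n [K [Phi [cPhi e1 e2]]]] /psd_sum_pure[M eM].
have eK i : ampl (fun rho => K i *m rho *m adjmx (K i)) rho0 = \sum_k pure (K i *m M k).
  rewrite eM (mx_linear_sum (ampl_linear (kraus_linear (K i)))).
  by apply: eq_bigr => k _; exact: ampl_kraus_pure.
(* One pure state for each Kraus outcome and each rank-one term of [rho0]; the later map depends on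
   the outcome alone. *)
exists ('I_n * 'I_(d * d))%type, (fun x => K x.1 *m M x.2), (fun x => Phi x.1).
split=> [x||]; first exact: cPhi.
- rewrite -(pair_bigA _ (fun i k => pure (K i *m M k))) /=.
  (* At the first time the outcome is followed by the identity map. *)
  rewrite (ampl_sum_comp (Phi := fun _ rho => rho) _ e1); apply: eq_bigr => i _.
  rewrite -eK; apply/matrixP => p q.
  by rewrite mxE mxE !biK.
- rewrite -(pair_bigA _ (fun i k => ampl (Phi i) (pure (K i *m M k)))) /=.
  rewrite (ampl_sum_comp _ e2); apply: eq_bigr => i _; rewrite eK.
  by have [lin _ _] := cPhi i; rewrite (mx_linear_sum (ampl_linear lin)).
Qed.

Lemma F_Delta_ge0 d (E1 E2 : 'M[C]_d -> 'M[C]_d) (rho0 : 'M[C]_(d * d)) :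
  (2 <= d)%N -> CPT E1 -> density rho0 -> classical_memory E1 E2 ->
  0 <= F_Delta E1 E2 rho0.
Proof.
move=> d2 [_ _ tp1] [p0 tr0] /classical_memory_unravelling/(_ p0).
move=> [I [M [Phi [cPhi e1 e2]]]].
have t1 : \sum_i Re (\tr (M i *m adjmx (M i))) = 1.
  rewrite -Re_sum; under eq_bigr => i _ do rewrite -tr_pure.
  by rewrite -raddf_sum /= -e1 tr_ampl // tr0.
(* The intermediate quantity: [D * G] dominates the negativity at the second time, and [G] is at
   most the entropy root of either marginal at the first. *)
pose G := \sum_i Num.sqrt (Re (\tr (M i *m adjmx (M i))) ^+ 2 - purity (M i)).
pose D : R := Num.sqrt (d%:R * (d%:R - 1)).
have bound : trnorm_bound (ptransA (ampl E2 rho0)) (1 + D * G).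
  rewrite e2 ptransA_sum -t1 mulr_sumr -big_split /=.
  apply: trnorm_bound_sum => i; rewrite ptransA_ampl; apply: trnorm_bound_ampl => //.
  by have [] := trnorm_bound_pure (M i).
have GA : G <= Num.sqrt (1 - Re (\tr (ptrA (ampl E1 rho0) *m ptrA (ampl E1 rho0)))).
  rewrite e1 ptrA_sum; apply: negativity_le_linear_entropy => // i; rewrite ptrA_pure //.
  exact/psd_herm/psd_gram.
have GS : G <= Num.sqrt (1 - Re (\tr (ptrS (ampl E1 rho0) *m ptrS (ampl E1 rho0)))).
  rewrite e1 ptrS_sum; apply: negativity_le_linear_entropy => // i; rewrite ptrS_pure.
    by rewrite adjmx_tr adjmxM adjmxK.
  (* Cyclicity of the trace: both marginals of a pure state have the same purity. *)
  by rewrite -trmx_mul mxtrace_tr /purity !mulmxA mxtrace_mulC !mulmxA.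
rewrite /F_Delta subr_ge0.
set N := Num.sqrt (2 / _).
(* The normalisation cancels the pair count, nonzero as [2 <= d], leaving the factor [Num.sqrt 2] of
   the entropy terms. *)
have ND : N * D = Num.sqrt 2.
  have d_gt0 : 0 < d%:R * (d%:R - 1) :> R.
    by rewrite mulr_gt0 ?subr_gt0 ?ltr1n ?ltr0n // ltnW.
  rewrite -sqrtrM ?mulfVK ?gt_eqF // divr_ge0 // ltW //.
have negativity_le : N * Num.max (trnorm (ptransS (ampl E2 rho0)) - 1)
    (trnorm (ptransA (ampl E2 rho0)) - 1) <= Num.sqrt 2 * G.
  rewrite -ND -mulrA ler_wpM2l ?sqrtr_ge0 // ge_max !lerBlDl.
  by rewrite ptransS_tr !trnorm_boundP //; exact: trnorm_bound_tr.
have sqrt2 x : Num.sqrt (2 * x) = Num.sqrt 2 * Num.sqrt x :> R by rewrite sqrtrM.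
apply: le_trans negativity_le _.
by rewrite !sqrt2 le_min; apply/andP; split; apply: ler_wpM2l => //; exact: sqrtr_ge0.
Qed.

End Operators.

Theorem theorem1 (R : realType) (d : nat) (E1 E2 : 'M[R[i]]_d -> 'M[R[i]]_d)
    (rho0 : 'M[R[i]]_(d * d)) :
  (2 <= d)%N ->
  CPT E1 -> CPT E2 ->
  density rho0 ->
  0 < Delta E1 E2 rho0 ->
  ~ classical_memory E1 E2.
Proof.
move=> d2 cE1 _ hrho; rewrite /Delta lt_max ltxx /= oppr_gt0 => F_lt0 cm.
by have := F_Delta_ge0 d2 cE1 hrho cm; rewrite leNgt F_lt0.
Qed.
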